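(* Let $\mathcal L$ be an indecomposable Lie algebra over a field $\mathbb F$ in the family $\mathrm{Lie}(n,1)$. Then the commuting graph of $\mathcal L$ is connected if and only if $\mathcal L$ is isomorphic to $\mathfrak h_{2m+1}$ for some $m\ge 2$. Moreover, for every $m\ge 2$, $\mathrm{diam}(\Gamma(\mathfrak h_{2m+1}))=2$.
   Context: For a noncommutative (i.e. nonabelian) Lie algebra $\mathcal L$ with center $Z(\mathcal L)$, the commuting graph $\Gamma(\mathcal L)$ is the simple undirected graph with vertex set $V_{\mathcal L}=\mathcal L\setminus Z(\mathcal L)$, in which two distinct vertices $x,y$ are adjacent if and only if $[x,y]=0$. A graph is connected if every pair of distinct vertices is joined by a path, and the diameter of a connected graph is the supremum of the distances (lengths of shortest paths) between distinct vertices. A Lie algebra is indecomposable if it is not the direct sum (as Lie algebras) of two non-trivial Lie subalgebras. $\mathrm{Lie}(n,k)$ denotes the family of all Lie algebras of dimension $n$ whose derived algebra $\mathcal L^1=[\mathcal L,\mathcal L]$ has dimension $k$. $\mathfrak h_{2m+1}$ is the $(2m+1)$-dimensional Lie algebra over $\mathbb F$ with basis $e_1,\ldots,e_{2m+1}$ and non-trivial brackets $[e_i,e_{i+m}]=e_{2m+1}$ for $1\le i\le m$ (all other brackets $[e_i,e_j]$ with $i<j$ are zero). *)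

(* Defs.v *)
From HB Require Import structures.
From mathcomp Require Import all_boot all_order all_algebra.
Set Implicit Arguments. Unset Strict Implicit. Unset Printing Implicit Defensive.
Import GRing.Theory.
Local Open Scope ring_scope.

(* Finite-dimensional Lie algebras over a field of arbitrary characteristic;
   [x, x] = 0 is required rather than mere antisymmetry. *)
HB.mixin Record Vector_isLie (F : fieldType) (L : Type) of Vector F L := {
  lie : L -> L -> L;
  lie_is_linear : forall x, linear (lie x);
  liel_is_linear : forall y, linear (lie^~ y);
  liexx : forall x, lie x x = 0;
  lie_jacobi : forall x y z,
    lie x (lie y z) + lie y (lie z x) + lie z (lie x y) = 0
}.

#[short(type="lieAlgType")]
HB.structure Definition LieAlgebra (F : fieldType) :=
  { L of Vector F L & Vector_isLie F L }.

HB.instance Definition _ (F : fieldType) (L : lieAlgType F) (x : L) :=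
  GRing.isLinear.Build F L L *:%R (lie x) (lie_is_linear x).

Lemma lieDl (F : fieldType) (L : lieAlgType F) (y : L) :
  {morph (lie^~ y) : x z / x + z}.
Proof. by move=> x z; have := liel_is_linear y 1 x z; rewrite !scale1r. Qed.

Lemma lie0l (F : fieldType) (L : lieAlgType F) (y : L) : lie 0 y = 0.
Proof. by apply: (addIr (lie 0 y)); rewrite -lieDl !add0r. Qed.

Lemma lieZl (F : fieldType) (L : lieAlgType F) a (x y : L) :
  lie (a *: x) y = a *: lie x y.
Proof. by have := liel_is_linear y a x 0; rewrite !addr0 lie0l addr0. Qed.

Lemma lieC (F : fieldType) (L : lieAlgType F) (x y : L) : lie x y = - lie y x.
Proof.
apply/eqP; rewrite -addr_eq0.
by have := liexx (x + y); rewrite lieDl !linearD /= !liexx add0r addr0 => ->.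
Qed.

Definition ad (F : fieldType) (L : lieAlgType F) (x : L) : 'End(L) :=
  linfun (lie x).

Lemma ad_is_linear (F : fieldType) (L : lieAlgType F) : linear (@ad F L).
Proof.
move=> a x y; apply/lfunP=> z.
by rewrite !lfunE /= !lfunE /= lfunE /= liel_is_linear.
Qed.

HB.instance Definition _ (F : fieldType) (L : lieAlgType F) :=
  GRing.isLinear.Build F L 'End(L) *:%R (@ad F L) (@ad_is_linear F L).

Definition lie_center (F : fieldType) (L : lieAlgType F) : {vspace L} :=
  lker (linfun (@ad F L)).

Lemma lie_centerP (F : fieldType) (L : lieAlgType F) (x : L) :
  reflect (forall y, lie x y = 0) (x \in lie_center L).
Proof.
rewrite memv_ker lfunE /=; apply: (iffP eqP) => [x0 y | x0].
  by have := congr1 (fun f : 'End(L) => f y) x0; rewrite lfunE zero_lfunE.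
by apply/lfunP=> y; rewrite lfunE zero_lfunE /= x0.
Qed.

(* The span of the brackets of basis vectors, which is the span of all
   brackets by derivedP. *)
Definition derived (F : fieldType) (L : lieAlgType F) : {vspace L} :=
  <<[seq lie x y | x <- vbasis {:L}, y <- vbasis {:L}]>>%VS.

Lemma derivedP (F : fieldType) (L : lieAlgType F) (U : {vspace L}) :
  (forall x y : L, lie x y \in U) <-> (derived L <= U)%VS.
Proof.
split=> [LU | /subvP dU x y].
  by apply/span_subvP=> _ /allpairsP[[x y] [_ _ ->]]; apply: LU.
apply: dU; rewrite (coord_vbasis (memvf x)) (coord_vbasis (memvf y)).
rewrite (big_morph _ (lieDl _) (lie0l _)); apply: rpred_sum => i _.
rewrite lieZl linear_sum; apply/rpredZ/rpred_sum => j _.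
rewrite linearZ; apply/rpredZ/memv_span/allpairs_f; apply: mem_nth;
  by rewrite size_tuple.
Qed.

Definition in_Lie (F : fieldType) (n k : nat) (L : lieAlgType F) : Prop :=
  \dim {:L} = n /\ \dim (derived L) = k.

Definition lie_subalgebra (F : fieldType) (L : lieAlgType F)
    (A : {vspace L}) : Prop :=
  {in A &, forall x y, lie x y \in A}.

Definition decomposable (F : fieldType) (L : lieAlgType F) : Prop :=
  exists A B : {vspace L},
    [/\ lie_subalgebra A, lie_subalgebra B, A != 0%VS & B != 0%VS] /\
    [/\ (A + B)%VS = fullv, (A :&: B)%VS = 0%VS
      & {in A & B, forall x y, lie x y = 0}].

Definition indecomposable (F : fieldType) (L : lieAlgType F) : Prop :=
  ~ decomposable L.

Definition lie_isomorphic (F : fieldType) (L M : lieAlgType F) : Prop :=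
  exists f : {linear L -> M},
    bijective f /\ forall x y, f (lie x y) = lie (f x) (f y).

(* A simple graph is a symmetric irreflexive relation on its vertex type,
   which may be infinite. *)

Definition path_between (T : eqType) (e : rel T) (x y : T) (p : seq T) : Prop :=
  [/\ path e x p, uniq (x :: p) & last x p = y].

Definition graph_connected (T : eqType) (e : rel T) : Prop :=
  forall x y, x != y -> exists p, path_between e x y p.

(* The tail p of the path x :: p has as many elements as the path has edges. *)
Definition distance_is (T : eqType) (e : rel T) (x y : T) (d : nat) : Prop :=
  (exists2 p, path_between e x y p & size p = d) /\
  (forall p, path_between e x y p -> d <= size p)%N.

(* e is connected, and the supremum of its distances is finite and equal to
   D. *)
Definition diameter_is (T : eqType) (e : rel T) (D : nat) : Prop :=
  let bound k := forall x y d, x != y -> distance_is e x y d -> (d <= k)%N in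
  [/\ graph_connected e, bound D & forall k, bound k -> (D <= k)%N].

Definition noncentral (F : fieldType) (L : lieAlgType F) : Type :=
  {x : L | x \notin lie_center L}.

HB.instance Definition _ (F : fieldType) (L : lieAlgType F) :=
  SubChoice.on (noncentral L).

Definition commuting_graph (F : fieldType) (L : lieAlgType F) :
    rel (noncentral L) :=
  fun x y => (x != y) && (lie (val x) (val y) == 0).
Arguments commuting_graph {F} L.

Lemma commuting_graph_sym (F : fieldType) (L : lieAlgType F) :
  symmetric (commuting_graph L).
Proof.
by move=> x y; rewrite /commuting_graph eq_sym lieC oppr_eq0.
Qed.

Lemma commuting_graph_irr (F : fieldType) (L : lieAlgType F) :
  irreflexive (commuting_graph L).
Proof. by move=> x; rewrite /commuting_graph eqxx. Qed.

(* Coordinates are numbered from 0, so that e_i is the i.-1-th vector of the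
   canonical basis and e_(2m+1) the last one. *)
Definition heisenberg (F : fieldType) (m : nat) : Type := 'rV[F]_m.*2.+1.

HB.instance Definition _ (F : fieldType) (m : nat) :=
  Vector.on (heisenberg F m).

Definition heis_basis (F : fieldType) (m : nat) (i : 'I_m.*2.+1) :
    heisenberg F m :=
  delta_mx 0 i.
Arguments heis_basis {F m} i.

Definition heis_form (F : fieldType) (m : nat) (x y : 'rV[F]_m.*2.+1) : F :=
  \sum_(i < m) (x 0 (inord i) * y 0 (inord (i + m))
                - x 0 (inord (i + m)) * y 0 (inord i)).

Definition heis_lie (F : fieldType) (m : nat) (x y : heisenberg F m) :
    heisenberg F m :=
  heis_form x y *: heis_basis ord_max.

Lemma heis_form_linearr (F : fieldType) m (x : 'rV[F]_m.*2.+1) :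
  scalar (heis_form x).
Proof.
move=> a y z; rewrite /heis_form mulr_sumr -big_split /=.
apply: eq_bigr => i _; rewrite !mxE mulrBr !mulrDr !mulrA.
by rewrite ![a * x _ _]mulrC opprD addrACA.
Qed.

Lemma heis_form_alt (F : fieldType) m (x : 'rV[F]_m.*2.+1) : heis_form x x = 0.
Proof. by apply: big1 => i _; rewrite mulrC subrr. Qed.

Lemma heis_formC (F : fieldType) m (x y : 'rV[F]_m.*2.+1) :
  heis_form x y = - heis_form y x.
Proof.
rewrite /heis_form -sumrN; apply: eq_bigr => i _.
by rewrite opprB; congr (_ - _); rewrite mulrC.
Qed.

Lemma heis_form_center (F : fieldType) m (x : 'rV[F]_m.*2.+1) a :
  heis_form x (a *: delta_mx 0 ord_max) = 0.
Proof.
apply: big1 => i _.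
have lti := ltn_ord i.
have imm : (i + m < m.*2.+1)%N by rewrite ltnS -addnn leq_add2r ltnW.
have im : (i < m.*2.+1)%N by rewrite (leq_ltn_trans _ imm) ?leq_addr.
have im2 : (i + m)%N != m.*2 by rewrite -addnn eqn_add2r ltn_eqF.
have i2 : (i : nat) != m.*2 by rewrite -addnn ltn_eqF // ltn_addl.
rewrite !mxE !eqxx /= -!val_eqE /= !inordK //.
by rewrite (negPf im2) (negPf i2) !mulr0 subrr.
Qed.

Fact heis_lie_linear (F : fieldType) m (x : heisenberg F m) :
  linear (heis_lie x).
Proof.
by move=> a y z; rewrite /heis_lie heis_form_linearr scalerDl scalerA.
Qed.

Fact heis_liel_linear (F : fieldType) m (y : heisenberg F m) :
  linear ((@heis_lie F m)^~ y).
Proof.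
move=> a x z; rewrite /heis_lie heis_formC heis_form_linearr.
by rewrite opprD -mulrN -!(heis_formC _ y) scalerDl scalerA.
Qed.

Fact heis_liexx (F : fieldType) m (x : heisenberg F m) : heis_lie x x = 0.
Proof. by rewrite /heis_lie heis_form_alt scale0r. Qed.

Fact heis_lie_jacobi (F : fieldType) m (x y z : heisenberg F m) :
  heis_lie x (heis_lie y z) + heis_lie y (heis_lie z x)
  + heis_lie z (heis_lie x y) = 0.
Proof. by rewrite /heis_lie !heis_form_center !scale0r !addr0. Qed.

HB.instance Definition _ (F : fieldType) (m : nat) :=
  Vector_isLie.Build F (heisenberg F m) (@heis_lie_linear F m)
    (@heis_liel_linear F m) (@heis_liexx F m) (@heis_lie_jacobi F m).

Lemma heis_lie_basis (F : fieldType) m (i j : 'I_m.*2.+1) : (i < j)%N ->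
  lie (heis_basis i) (heis_basis j) =
    if (i < m)%N && (j == i + m :> nat)%N then heis_basis ord_max
    else 0 :> heisenberg F m.
Proof.
move=> ij; rewrite /lie /= /heis_lie /heis_form.
have inK (k : 'I_m) : (inord k : 'I_m.*2.+1) = k :> nat.
  by rewrite inordK // ltnS -addnn ltnW // ltn_addl.
have inmK (k : 'I_m) : (inord (k + m) : 'I_m.*2.+1) = (k + m)%N :> nat.
  by rewrite inordK // ltnS -addnn leq_add2r ltnW.
have second0 (k : 'I_m) : (heis_basis i : 'rV[F]_m.*2.+1) 0 (inord (k + m))
    * (heis_basis j : 'rV[F]_m.*2.+1) 0 (inord k) = 0.
  rewrite !mxE /= -!val_eqE /= inK inmK.
  case: eqP => [ki|_]; last by rewrite mul0r.
  case: eqP => [kj|_]; last by rewrite mulr0.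
  by move: ij; rewrite -ki -kj ltnNge leq_addr.
under eq_bigr => k _ do rewrite second0 subr0.
have [im|mi] /= := ltnP i m; last first.
  rewrite big1 ?scale0r // => k _; rewrite !mxE /= -!val_eqE /= inK.
  by rewrite ltn_eqF ?mul0r // (leq_trans (ltn_ord k)).
rewrite (bigD1 (Ordinal im)) //= big1 ?addr0 => [|k kim].
  rewrite !mxE -!val_eqE /= (inK (Ordinal im)) (inmK (Ordinal im)) /= !eqxx.
  by rewrite mul1r eq_sym; case: eqP => _; rewrite ?scale1r ?scale0r.
rewrite !mxE /= -[_ == i]val_eqE /= inK.
by move: kim; rewrite -val_eqE /= => /negPf->; rewrite mul0r.
Qed.

(* Main.v *)
From HB Require Import structures.
Require Import Defs.
From mathcomp Require Import all_boot all_order all_algebra zify.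

(** The key is the codimension of the center.  Let L be a Lie algebra whose
derived algebra is a line <[z]>.

Since ad x takes its values in a line, every centralizer has codimension at
most 1, and the common centralizer of two elements has codimension at most 2.
If the center has codimension at least 3, any two vertices of the commuting
graph therefore commute with a common noncentral element, so the graph is
connected of diameter 2 (diameter2_of_large_center_codim).  If the center has
codimension at most 2, the centralizer of a noncentral u is reduced to
<[u]> + Z(L); commuting is then a transitive relation on noncentral elements,
and no path joins two elements that do not commute
(disconnected_of_small_center_codim).  So the graph is connected exactly when
dim L > dim Z(L) + 2.

It remains to identify the indecomposable algebras with this property.  If z
is not central, say [x, z] != 0, the Jacobi identity shows that whatever
commutes with both x and z is central, so the center has codimension at most 2
(small_center_codim_of_noncentral_derived).  If z is central and L is
indecomposable, then Z(L) = <[z]>, because a complement of <[z]> in Z(L) would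
split off (center_sub_derived_of_indecomposable).  The bracket then induces a
nondegenerate alternating form on L / <[z]> with values in <[z]>, and a
symplectic basis for it identifies L with some h_(2m+1)
(isomorphic_heisenberg), where 2m+1 > 3 means m >= 2.  Conversely, the center
of h_(2m+1) has dimension at most 1, hence codimension at least 3 as soon as
m >= 2. *)

Set Implicit Arguments. Unset Strict Implicit.
Unset Printing Implicit Defensive.
Import GRing.Theory.
Local Open Scope ring_scope.

(** * Centralizers and the commuting graph *)

Section LieAlgebraFacts.
Variables (F : fieldType) (L : lieAlgType F).
Implicit Types (x y u v w : L).

Lemma centralizerP x u : reflect (lie x u = 0) (u \in lker (ad x)).
Proof. by rewrite memv_ker lfunE; apply: eqP. Qed.

Lemma lie_centerPn x : reflect (exists y, lie x y != 0) (x \notin lie_center L).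
Proof.
rewrite memv_ker lfunE; apply: (iffP lfunPn) => -[y].
  by rewrite lfunE zero_lfunE; exists y.
by exists y; rewrite lfunE zero_lfunE.
Qed.

Lemma centerr x c : c \in lie_center L -> lie x c = 0.
Proof. by move/lie_centerP=> cZ; rewrite lieC cZ oppr0. Qed.

Lemma noncentrall x y : lie x y != 0 -> x \notin lie_center L.
Proof. by move=> xy; apply/lie_centerPn; exists y. Qed.

Lemma noncentralr x y : lie x y != 0 -> y \notin lie_center L.
Proof. by rewrite lieC oppr_eq0; apply: noncentrall. Qed.

Lemma lie_in_derived x y : lie x y \in derived L.
Proof. exact: (derivedP (derived L)).2. Qed.

Lemma center_sub_centralizer x : (lie_center L <= lker (ad x))%VS.
Proof. by apply/subvP=> c cZ; apply/centralizerP/centerr. Qed.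

Lemma derived_neq0 : derived L != 0%VS -> exists x y, lie x y != 0.
Proof.
rewrite -subv0 => dN0.
have [/subvP cT|/subvPn[x _ xnc]] := boolP (fullv <= lie_center L)%VS.
  case/negP: dN0; apply/derivedP => x y.
  by move: (cT x (memvf x)) => /lie_centerP ->; rewrite mem0v.
by have /lie_centerPn[y xy] := xnc; exists x, y.
Qed.

(** Rank-nullity for ad x, whose image lies in the derived algebra. *)
Lemma dim_centralizer x :
  (\dim {:L} <= \dim (lker (ad x)) + \dim (derived L))%N.
Proof.
rewrite -(limg_ker_dim (ad x) fullv) capfv leq_add2l dimvS //.
by apply/subvP=> _ /memv_imgP[u _ ->]; rewrite lfunE lie_in_derived.
Qed.

Lemma dim_common_centralizer x y : (\dim (derived L) <= 1)%N ->
  (\dim {:L} <= \dim (lker (ad x) :&: lker (ad y)) + 2)%N.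
Proof.
move=> d1; have := dimv_sum_cap (lker (ad x)) (lker (ad y)).
have := dim_centralizer x; have := dim_centralizer y.
by have := dimvS (subvf (lker (ad x) + lker (ad y))%VS); lia.
Qed.

(** The common centralizer of two vertices has codimension at most 2, so it
cannot fit in a center of codimension at least 3.  If the two vertices do not
commute, a noncentral element of this common centralizer is a third vertex
adjacent to both, and their distance is exactly 2. *)
Lemma diameter2_of_large_center_codim :
  (\dim (derived L) <= 1)%N -> derived L != 0%VS ->
  (\dim (lie_center L) + 2 < \dim {:L})%N ->
  diameter_is (commuting_graph L) 2.
Proof.
move=> d1 dN0 big.
have short (x y : noncentral L) : x != y ->
    exists2 p, path_between (commuting_graph L) x y p & (size p <= 2)%N.
  move=> xy; have [xy0|xyN0] := eqVneq (lie (val x) (val y)) 0.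
    exists [:: y] => //; split; rewrite //= ?andbT ?inE //.
    by rewrite /commuting_graph xy xy0 eqxx.
  have : ~~ (lker (ad (val x)) :&: lker (ad (val y)) <= lie_center L)%VS.
    apply: contraL big => /dimvS le; rewrite -leqNgt.
    apply: leq_trans (dim_common_centralizer (val x) (val y) d1) _.
    by rewrite leq_add2r.
  case/subvPn=> w /memv_capP[/centralizerP xw /centralizerP yw] wnc.
  pose w' : noncentral L := exist _ w wnc.
  have xw' : x != w'.
    by apply: contraNneq xyN0 => ->; rewrite lieC /= yw oppr0.
  have w'y : w' != y by apply: contraNneq xyN0 => <-; rewrite /= xw.
  exists [:: w'; y] => //; split=> //=; last first.
    by rewrite !inE negb_or xw' xy w'y.
  by rewrite /commuting_graph xw' w'y /= xw lieC yw oppr0 eqxx.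
split=> [x y /short[p xyp _]|x y d xy [_ le]|k bk]; first by exists p.
  by have [p /le dp p2] := short x y xy; apply: leq_trans dp p2.
have [x [y xyN0]] := derived_neq0 dN0.
pose x' : noncentral L := exist _ x (noncentrall xyN0).
pose y' : noncentral L := exist _ y (noncentralr xyN0).
have xy' : x' != y'.
  by apply: contraNneq (xyN0) => /(congr1 val) /= ->; rewrite liexx.
have ge2 p : path_between (commuting_graph L) x' y' p -> (2 <= size p)%N.
  case: p => [|a [|b p]] [] //= pth _ ly; first by rewrite ly eqxx in xy'.
  by move: pth; rewrite ly /commuting_graph /= (negPf xyN0) andbF.
apply: (bk x' y') => //; split=> //.
have [p xyp p2] := short _ _ xy'; exists p => //.
by apply/eqP; rewrite eqn_leq p2 ge2.
Qed.

(** The centralizer of a noncentral u is a proper subspace containing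
<[u]> + Z(L).  When the center has codimension at most 2, the latter is at
least a hyperplane, so the two are equal; and <[u]> + Z(L) is abelian. *)
Lemma commuting_transitive x u v :
  (\dim {:L} <= \dim (lie_center L) + 2)%N -> u \notin lie_center L ->
  lie u x = 0 -> lie u v = 0 -> lie x v = 0.
Proof.
move=> small unc ux uv.
have disj : (<[u]> :&: lie_center L = 0)%VS.
  apply/eqP; rewrite -subv0; apply/subvP=> _ /memv_capP[/vlineP[a ->]].
  rewrite memv0; have [->|aN0] := eqVneq a 0; first by rewrite scale0r.
  by rewrite rpredZeq (negPf aN0) (negPf unc).
have sub : (<[u]> + lie_center L <= lker (ad u))%VS.
  rewrite subv_add center_sub_centralizer -memvE andbT.
  exact/centralizerP/liexx.
have prop : (\dim (lker (ad u)) < \dim {:L})%N.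
  rewrite (ltn_leqif (dimv_leqif_sup (subvf _))).
  have /lie_centerPn[y uy] := unc; apply/negP => /subvP/(_ y (memvf y)).
  by move/centralizerP/eqP; apply/negP.
have : x \in (<[u]> + lie_center L)%VS.
  have : x \in lker (ad u) by apply/centralizerP.
  suff /eqP <- : (<[u]> + lie_center L)%VS == lker (ad u) by [].
  have uN0 : u != 0 by apply: contraNneq unc => ->; rewrite mem0v.
  by rewrite eqEdim sub dimv_disjoint_sum // dim_vline uN0; lia.
case/memv_addP=> _ /vlineP[a ->] [c /lie_centerP cZ ->].
by rewrite lieDl lieZl uv scaler0 cZ addr0.
Qed.

(** By transitivity, every vertex on a path from x commutes with x; but some x
and y do not commute. *)
Lemma disconnected_of_small_center_codim :
  derived L != 0%VS -> (\dim {:L} <= \dim (lie_center L) + 2)%N ->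
  ~ graph_connected (commuting_graph L).
Proof.
move=> dN0 small conn; have [x [y xyN0]] := derived_neq0 dN0.
pose x' : noncentral L := exist _ x (noncentrall xyN0).
pose y' : noncentral L := exist _ y (noncentralr xyN0).
have xy' : x' != y'.
  by apply: contraNneq (xyN0) => /(congr1 val) /= ->; rewrite liexx.
have [p [pth _ ly]] := conn x' y' xy'.
suff : lie x (val (last x' p)) = 0 by rewrite ly => /eqP; apply/negP.
have reach (u : noncentral L) q : lie x (val u) = 0 ->
    path (commuting_graph L) u q -> lie x (val (last u q)) = 0.
  elim: q u => [|v q IH] u //= xu /andP[/andP[_ /eqP uv]]; apply: IH.
  apply: commuting_transitive uv => //; first by case: (u).
  by rewrite lieC xu oppr0.
by apply: reach pth; rewrite liexx.
Qed.

(** Choose z in the derived algebra and x with [z, x] != 0.  If w commutes with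
x and z, it commutes with [y, x], which is a multiple of z, and the Jacobi
identity for x, w, y leaves [x, [w, y]] = 0.  As [w, y] is a multiple of z, it
vanishes.  Thus the common centralizer of x and z is central, and it has
codimension at most 2. *)
Lemma small_center_codim_of_noncentral_derived :
  (\dim (derived L) <= 1)%N -> ~~ (derived L <= lie_center L)%VS ->
  (\dim {:L} <= \dim (lie_center L) + 2)%N.
Proof.
move=> d1 /subvPn[z zD /lie_centerPn[x zx]].
have zN0 : z != 0 by apply: contraNneq zx => ->; rewrite lie0l.
have defD : derived L = <[z]>%VS.
  by apply/esym/eqP; rewrite eqEdim -memvE zD dim_vline zN0.
apply: leq_trans (dim_common_centralizer x z d1) _; rewrite leq_add2r.
apply/dimvS/subvP=> w /memv_capP[/centralizerP xw /centralizerP zw].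
have wz : lie w z = 0 by rewrite lieC zw oppr0.
apply/lie_centerP=> y.
have [a wy] : exists a, lie w y = a *: z.
  by apply/vlineP; rewrite -defD lie_in_derived.
have [b yx] : exists b, lie y x = b *: z.
  by apply/vlineP; rewrite -defD lie_in_derived.
have := lie_jacobi x w y.
rewrite wy yx xw !linear0 addr0 !linearZ /= wz scaler0 addr0 => /eqP.
rewrite scaler_eq0 lieC oppr_eq0 (negPf zx) orbF => /eqP ->.
by rewrite scale0r.
Qed.

(** Any subspace containing the derived algebra is a subalgebra, and so is any
subspace of the center.  A central complement to such a subspace is therefore
a direct factor, and one exists unless the derived algebra contains the
center. *)
Lemma center_sub_derived_of_indecomposable :
  derived L != 0%VS -> indecomposable L -> (lie_center L <= derived L)%VS.
Proof.
move=> dN0 ind; apply/negPn/negP => nsub; apply: ind.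
set Z := lie_center L; set D := derived L.
(* The second factor complements Z :&: D in Z, hence D in Z + D; the
   complement of Z + D is put on the side of D. *)
exists (D + (Z + D)^C)%VS, (Z :\: D)%VS.
have memC c : c \in (Z :\: D)%VS -> c \in lie_center L.
  exact/subvP/diffvSl.
have full : (D + (Z + D)^C + (Z :\: D) = fullv)%VS.
  by rewrite addvC addvA addv_diff addv_complf.
split; split=> //.
- by move=> x y _ _; apply: subvP (addvSl _ _) _ (lie_in_derived x y).
- by move=> x y /memC/lie_centerP-> _; rewrite mem0v.
- by apply: contraNneq dN0 => A0; rewrite -subv0 -A0 addvSl.
- by rewrite diffv_eq0.
- apply/eqP; rewrite -subv0 -(geq_leqif (dimv_add_leqif _ _)) full.
  have := dimv_add_leqif D (Z + D)^C => -[le _].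
  have := dimv_cap_compl Z D; have := dimv_sum_cap Z D.
  have := dimvS (subvf (Z + D)%VS); have := dimv_compl (Z + D)%VS.
  by move: le; rewrite /Z /D; lia.
by move=> x c _ /memC cZ; rewrite centerr.
Qed.

End LieAlgebraFacts.

(** * The Heisenberg algebras *)

Section Heisenberg.
Variables (F : fieldType) (m : nat).
Implicit Types (x y : heisenberg F m) (i j : 'I_m) (k : 'I_m.*2.+1).

Lemma heis_index_first i : (inord i : 'I_m.*2.+1) = i :> nat.
Proof. by rewrite inordK //; have := ltn_ord i; lia. Qed.

Lemma heis_index_second i : (inord (i + m) : 'I_m.*2.+1) = (i + m)%N :> nat.
Proof. by rewrite inordK //; have := ltn_ord i; lia. Qed.

Lemma heis_first_neq_last i : (inord i == ord_max :> 'I_m.*2.+1) = false.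
Proof.
apply/eqP => /(congr1 val); rewrite /= heis_index_first.
by have := ltn_ord i; lia.
Qed.

Lemma heis_second_neq_last i : (inord (i + m) == ord_max :> 'I_m.*2.+1) = false.
Proof.
apply/eqP => /(congr1 val); rewrite /= heis_index_second.
by have := ltn_ord i; lia.
Qed.

(** The 2m+1 indices, counted from 0, fall into the two halves of the symplectic
pairs (i, i+m) and the central index 2m. *)
Variant heis_index_spec k : Type :=
  | HeisFirst i of k = inord i
  | HeisSecond i of k = inord (i + m)
  | HeisLast of k = ord_max.

Lemma heis_indexP k : heis_index_spec k.
Proof.
have [km|mk] := ltnP k m.
  apply: (@HeisFirst _ (Ordinal km)); apply: ord_inj.
  by rewrite (heis_index_first (Ordinal km)).
have [km2|mk2] := ltnP k m.*2.
  have km : (k - m < m)%N by lia.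
  apply: (@HeisSecond _ (Ordinal km)); apply: ord_inj.
  by rewrite (heis_index_second (Ordinal km)) /= subnK.
by apply: HeisLast; apply: val_inj => /=; have := ltn_ord k; lia.
Qed.

(** The basis vectors of index i+m and i read off the coordinates of x of index
i and i+m, the latter up to sign: the form is nondegenerate modulo the last
basis vector. *)
Lemma heis_form_second x i :
  heis_form x (delta_mx 0 (inord (i + m))) = (x : 'rV[F]_m.*2.+1) 0 (inord i).
Proof.
rewrite /heis_form (bigD1 i) //= big1 ?addr0 => [|j jNi].
  rewrite !mxE /= -!val_eqE /= heis_index_first heis_index_second eqxx mulr1.
  by case: eqP => [|_]; [have := ltn_ord i; lia | rewrite mulr0 subr0].
rewrite !mxE /= -!val_eqE /= heis_index_first !heis_index_second eqn_add2r.
rewrite (negPf (jNi : j != i :> nat)) mulr0.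
by case: eqP => [|_]; [have := ltn_ord j; lia | rewrite mulr0 subr0].
Qed.

Lemma heis_form_first x i :
  heis_form x (delta_mx 0 (inord i)) = - (x : 'rV[F]_m.*2.+1) 0 (inord (i + m)).
Proof.
rewrite /heis_form (bigD1 i) //= big1 ?addr0 => [|j jNi].
  rewrite !mxE /= -!val_eqE /= heis_index_first heis_index_second eqxx mulr1.
  by case: eqP => [|_]; [have := ltn_ord i; lia | rewrite mulr0 sub0r].
rewrite !mxE /= -!val_eqE /= !heis_index_first !heis_index_second.
rewrite (negPf (jNi : j != i :> nat)) mulr0.
by case: eqP => [|_]; [have := ltn_ord i; lia | rewrite mulr0 subr0].
Qed.

Lemma heis_lieE x y : lie x y = heis_form x y *: heis_basis ord_max.
Proof. by []. Qed.

Lemma heis_basis_neq0 k : heis_basis k != 0 :> heisenberg F m.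
Proof.
apply/eqP => /matrixP/(_ 0 k); rewrite !mxE !eqxx => /eqP.
by rewrite oner_eq0.
Qed.

Lemma heis_center_sub :
  (lie_center (heisenberg F m) <= <[heis_basis ord_max]>)%VS.
Proof.
apply/subvP=> x /lie_centerP xZ.
have form0 y : heis_form x y = 0.
  apply/eqP; have := xZ y; rewrite heis_lieE => /eqP.
  by rewrite scaler_eq0 (negPf (heis_basis_neq0 _)) orbF.
apply/vlineP; exists ((x : 'rV[F]_m.*2.+1) 0 ord_max).
apply/rowP=> k; rewrite !mxE /=; case: (heis_indexP k) => [i|i|] ->.
- by rewrite -heis_form_second form0 heis_first_neq_last mulr0.
- rewrite -[LHS]opprK -heis_form_first form0 oppr0.
  by rewrite heis_second_neq_last mulr0.
- by rewrite eqxx mulr1.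
Qed.

Lemma dim_heis_center : (\dim (lie_center (heisenberg F m)) <= 1)%N.
Proof. by rewrite (leq_trans (dimvS heis_center_sub)) // dim_vline leq_b1. Qed.

Lemma dim_heis_derived : (\dim (derived (heisenberg F m)) <= 1)%N.
Proof.
apply: (@leq_trans (\dim <[heis_basis ord_max : heisenberg F m]>)).
  apply/dimvS/derivedP=> x y.
  by rewrite heis_lieE rpredZ // memv_line.
by rewrite dim_vline leq_b1.
Qed.

Lemma dim_heisenberg : \dim {:heisenberg F m} = m.*2.+1.
Proof. by rewrite dimvf; exact: mul1n. Qed.

Lemma heis_derived_neq0 : (0 < m)%N -> derived (heisenberg F m) != 0%VS.
Proof.
move=> m0; apply: contraNneq (heis_basis_neq0 ord_max) => d0.
have := lie_in_derived (heis_basis (inord (Ordinal m0)) : heisenberg F m)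
          (heis_basis (inord (Ordinal m0 + m))).
rewrite d0 memv0 heis_lieE heis_form_second mxE !eqxx scale1r.
exact.
Qed.

End Heisenberg.

Lemma heisenberg_large_center_codim (F : fieldType) m : (2 <= m)%N ->
  (\dim (lie_center (heisenberg F m)) + 2 < \dim {:heisenberg F m})%N.
Proof. by rewrite dim_heisenberg; have := dim_heis_center F m; lia. Qed.

Lemma lie_isomorphic_dim (F : fieldType) (L M : lieAlgType F) :
  lie_isomorphic L M ->
  \dim {:L} = \dim {:M} /\ (\dim (lie_center L) <= \dim (lie_center M))%N.
Proof.
case=> f [[g fK gK] fM]; pose h := linfun f.
have hE x : h x = f x by rewrite lfunE.
have ker0 : lker h = 0%VS.
  by apply/eqP/lker0P => x y; rewrite !hE; apply: can_inj fK _ _.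
have img U : \dim (h @: U) = \dim U by rewrite limg_dim_eq // ker0 capv0.
split.
  rewrite -(img fullv); congr (\dim _); apply/eqP; rewrite eqEsubv subvf /=.
  by apply/subvP=> y _; rewrite -(gK y) -hE memv_img ?memvf.
rewrite -img; apply/dimvS/subvP=> _ /memv_imgP[x /lie_centerP xZ ->].
by apply/lie_centerP=> y; rewrite hE -(gK y) -fM xZ linear0.
Qed.

(** * Symplectic bases *)

Section HyperbolicFamily.
Variables (F : fieldType) (L : lieAlgType F) (z : L).
Hypothesis zZ : z \in lie_center L.

(** A partial symplectic basis.  The families are indexed by nat, with only the
indices below m relevant, so that they can be extended without casts. *)
Definition hyperbolic m (e f : nat -> L) :=
  forall i j, (i < m)%N -> (j < m)%N ->
  [/\ lie (e i) (e j) = 0, lie (f i) (f j) = 0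
    & lie (e i) (f j) = (i == j)%:R *: z].

Definition heis_map m (e f : nat -> L) (v : heisenberg F m) : L :=
  \sum_(i < m) ((v : 'rV[F]_m.*2.+1) 0 (inord i) *: e i
                + (v : 'rV[F]_m.*2.+1) 0 (inord (i + m)) *: f i)
  + (v : 'rV[F]_m.*2.+1) 0 ord_max *: z.

Arguments heis_map : clear implicits.

Fact heis_map_is_linear m e f : linear (heis_map m e f).
Proof.
move=> a v w; rewrite /heis_map !mxE scalerDr addrACA scaler_sumr -big_split /=.
congr (_ + _); last by rewrite scalerDl scalerA.
apply: eq_bigr => i _; rewrite !mxE !scalerDl scalerDr !scalerA.
by rewrite addrACA.
Qed.

HB.instance Definition _ m e f :=
  GRing.isLinear.Build F (heisenberg F m) L *:%R (heis_map m e f)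
    (@heis_map_is_linear m e f).

Lemma lie_heis_map m e f x (v : heisenberg F m) :
  lie x (heis_map m e f v) =
    \sum_(i < m) ((v : 'rV[F]_m.*2.+1) 0 (inord i) *: lie x (e i)
                + (v : 'rV[F]_m.*2.+1) 0 (inord (i + m)) *: lie x (f i)).
Proof.
rewrite /heis_map linearD linearZ /= (centerr _ zZ) scaler0 addr0 linear_sum.
by apply: eq_bigr => i _; rewrite linearD !linearZ.
Qed.

Section OneFamily.
Variables (m : nat) (e f : nat -> L).
Hypothesis ef : hyperbolic m e f.
Implicit Types (v w : heisenberg F m) (i : 'I_m).

Lemma lie_first_heis_map i v :
  lie (e i) (heis_map m e f v) = (v : 'rV[F]_m.*2.+1) 0 (inord (i + m)) *: z.
Proof.
rewrite lie_heis_map (bigD1 i) //= big1 => [|j jNi].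
  have [-> _ ->] := ef (ltn_ord i) (ltn_ord i).
  by rewrite eqxx scaler0 add0r scale1r addr0.
have [-> _ ->] := ef (ltn_ord i) (ltn_ord j).
by rewrite eq_sym (negPf (jNi : j != i :> nat)) scale0r !scaler0 addr0.
Qed.

Lemma lie_second_heis_map i v :
  lie (f i) (heis_map m e f v) = - (v : 'rV[F]_m.*2.+1) 0 (inord i) *: z.
Proof.
rewrite lie_heis_map (bigD1 i) //= big1 => [|j jNi].
  have [_ -> _] := ef (ltn_ord i) (ltn_ord i).
  have [_ _ fe] := ef (ltn_ord i) (ltn_ord i).
  by rewrite lieC fe eqxx scaler0 scale1r !addr0 scalerN scaleNr.
have [_ -> _] := ef (ltn_ord i) (ltn_ord j).
have [_ _ fe] := ef (ltn_ord j) (ltn_ord i).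
by rewrite lieC fe (negPf (jNi : j != i :> nat)) scale0r oppr0 !scaler0 addr0.
Qed.

Lemma heis_map_last a : heis_map m e f (a *: heis_basis ord_max) = a *: z.
Proof.
rewrite linearZ /= /heis_map big1 => [|i _].
  by rewrite mxE !eqxx scale1r add0r.
by rewrite !mxE heis_first_neq_last heis_second_neq_last !scale0r addr0.
Qed.

Lemma heis_mapM v w :
  heis_map m e f (lie v w) = lie (heis_map m e f v) (heis_map m e f w).
Proof.
rewrite heis_lieE heis_map_last lieC lie_heis_map -sumrN scaler_suml.
apply: eq_bigr => i _.
rewrite ![lie (heis_map _ _ _ _) _]lieC lie_first_heis_map lie_second_heis_map.
by rewrite !scaleNr !opprK scalerN opprD opprK !scalerA scalerBl.
Qed.

Hypothesis zN0 : z != 0.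

(** Bracketing with the e_i and f_i recovers the first 2m coordinates of v from
its image, and the last one is then the coefficient of z. *)
Lemma heis_map_inj : injective (heis_map m e f).
Proof.
apply: raddf_inj => v v0.
have coord0 a : a *: z = 0 -> a = 0.
  by move/eqP; rewrite scaler_eq0 (negPf zN0) orbF => /eqP.
have first0 i : (v : 'rV[F]_m.*2.+1) 0 (inord i) = 0.
  apply: oppr_inj; rewrite oppr0; apply: coord0.
  by rewrite -lie_second_heis_map v0 linear0.
have second0 i : (v : 'rV[F]_m.*2.+1) 0 (inord (i + m)) = 0.
  by apply: coord0; rewrite -lie_first_heis_map v0 linear0.
apply/rowP=> k; rewrite mxE; case: (heis_indexP k) => [i|i|] -> //.
apply: coord0; rewrite -[RHS]v0 /= /heis_map big1 ?add0r // => i _.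
by rewrite first0 second0 !scale0r addr0.
Qed.

Lemma heis_map_dim : (m.*2.+1 <= \dim {:L})%N.
Proof.
rewrite -(dim_heisenberg F m) -(@limg_dim_eq _ _ _ (linfun (heis_map m e f))).
  exact/dimvS/subvf.
apply/eqP; rewrite capfv; apply/lker0P => v w.
by rewrite !lfunE => /heis_map_inj.
Qed.

Hypothesis lie_z : forall x y : L, lie x y \in <[z]>%VS.

(** Every x has a component orthogonal to a given hyperbolic family. *)
Lemma heis_map_projection x : exists v : heisenberg F m,
  forall i : nat, (i < m)%N ->
  lie (e i) (x - heis_map m e f v) = 0 /\ lie (f i) (x - heis_map m e f v) = 0.
Proof.
(* lie_first_heis_map and lie_second_heis_map dictate the coordinates of v:
   the k-th one is minus the coefficient of [f_k, x] for k < m, and the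
   coefficient of [e_(k-m), x] for m <= k < 2m.  The coordinate of index 2m is
   free, and the second formula is used for it too. *)
have /fin_all_exists[c cP] (k : 'I_m.*2.+1) :
    exists a, lie (if (k < m)%N then - f k else e (k - m)%N) x = a *: z.
  exact/vlineP.
exists (\row_k c k : 'rV_m.*2.+1) => i im; pose j := Ordinal im.
rewrite !linearB /=.
have [Ee Ef] := (lie_first_heis_map j (\row_k c k : 'rV_m.*2.+1),
                 lie_second_heis_map j (\row_k c k : 'rV_m.*2.+1)).
rewrite /= in Ee Ef; rewrite Ee Ef !mxE scaleNr.
rewrite -(cP (inord i)) -(cP (inord (i + m))).
rewrite (heis_index_first j) (heis_index_second j) /= im addnK.
rewrite [(i + m < m)%N]ltnNge leq_addl /= subrr; split=> //.
by rewrite opprK -lieDl subrr lie0l.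
Qed.

(** If x is not in the image, its component x' orthogonal to the family is not
a multiple of z, so it is not central.  Some y has a nonzero bracket with x',
and replacing y by its orthogonal component y' does not change this bracket.
After rescaling y', the pair (x', y') extends the family. *)
Lemma hyperbolic_extend x :
  (lie_center L <= <[z]>)%VS -> (forall v, x != heis_map m e f v) ->
  exists e' f', hyperbolic m.+1 e' f'.
Proof.
move=> Zz xNg; have [v vP] := heis_map_projection x.
set x' := x - heis_map m e f v in vP.
have : x' \notin lie_center L.
  apply/negP => /(subvP Zz)/vlineP[a x'E].
  have /eqP[] := xNg (v + a *: (heis_basis ord_max : heisenberg F m)).
  by rewrite linearD /= heis_map_last -x'E addrC subrK.
case/lie_centerPn=> y x'y; have [u uP] := heis_map_projection y.
set y' := y - heis_map m e f u in uP.
have perp (w : L) : lie w x' = 0 -> lie x' w = 0.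
  by move=> wx; rewrite lieC wx oppr0.
have x'y' : lie x' y' = lie x' y.
  rewrite /y' linearB /= lie_heis_map big1 ?subr0 // => i _.
  have [/perp-> /perp->] := vP i (ltn_ord i).
  by rewrite !scaler0 addr0.
have [a x'yE] : exists a, lie x' y = a *: z by apply/vlineP.
have aN0 : a != 0 by apply: contraNneq x'y => a0; rewrite x'yE a0 scale0r.
exists (fun k : nat => if k == m then x' else e k).
exists (fun k : nat => if k == m then a^-1 *: y' else f k) => i j.
rewrite !ltnS (leq_eqVlt i) (leq_eqVlt j).
case: eqVneq => [-> _|iNm /= im]; case: eqVneq => [-> _|jNm /= jm].
- by rewrite !liexx linearZ /= x'y' x'yE scalerA mulVf //.
- have [ex fx] := vP j jm; have [ey fy] := uP j jm.
  rewrite (lieC x' (e j)) ex lieZl (lieC y') fy (lieC x') fx.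
  by rewrite !oppr0 scaler0 scale0r.
- have [ex fx] := vP i im; have [ey fy] := uP i im.
  by rewrite ex !linearZ /= ey fy !scaler0 (negPf iNm) scale0r.
exact: ef.
Qed.

End OneFamily.

(** Extending a hyperbolic family as long as possible ends with a symplectic
basis of L modulo z, since a family of m pairs needs dimension 2m+1. *)
Lemma heis_map_surjective :
  z != 0 -> (forall x y : L, lie x y \in <[z]>%VS) ->
  (lie_center L <= <[z]>)%VS ->
  exists m e f, hyperbolic m e f /\ forall x, exists v, x = heis_map m e f v.
Proof.
move=> zN0 lie_z Zz.
suff grow d m e f : hyperbolic m e f -> (\dim {:L} <= m + d)%N ->
    exists m e f, hyperbolic m e f /\ forall x, exists v, x = heis_map m e f v.
  by apply: (grow (\dim {:L}) 0%N (fun=> 0) (fun=> 0)).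
elim: d m e f => [|d IH] m e f ef le.
  by have := heis_map_dim ef zN0; move: le; lia.
have [/subvP onto|/subvPn[x _ xNg]] :=
    boolP (fullv <= limg (linfun (heis_map m e f)))%VS.
  exists m, e, f; split=> // x; have /memv_imgP[v _ ->] := onto x (memvf x).
  by exists v; rewrite lfunE.
have [v|e' [f' ef']] := hyperbolic_extend ef lie_z Zz (x := x).
  by apply: contraNneq xNg => ->; rewrite -lfunE memv_img ?memvf.
by apply: IH ef' _; rewrite addSnnS.
Qed.

End HyperbolicFamily.

Lemma isomorphic_heisenberg (F : fieldType) (L : lieAlgType F) :
  \dim (derived L) = 1%N -> lie_center L = derived L ->
  exists m, lie_isomorphic L (heisenberg F m).
Proof.
move=> d1 ZD; pose z := vpick (derived L).
have zN0 : z != 0 by rewrite vpick0 -dimv_eq0 d1.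
have defD : derived L = <[z]>%VS.
  by apply/esym/eqP; rewrite eqEdim -memvE memv_pick dim_vline zN0 d1.
have zZ : z \in lie_center L by rewrite ZD memv_pick.
have lie_z (x y : L) : lie x y \in <[z]>%VS by rewrite -defD lie_in_derived.
have [|m [e [f [ef onto]]]] := heis_map_surjective zZ zN0 lie_z.
  by rewrite ZD defD.
exists m; pose g := linfun (@heis_map F L z m e f).
have ker0 : lker g == 0%VS.
  by apply/lker0P => v w; rewrite !lfunE; apply: (heis_map_inj zZ ef zN0).
have gK := lker0_lfunK ker0.
have gK' : cancel (g^-1)%VF g.
  by move=> x; have [v ->] := onto x; rewrite -[heis_map _ _ _ _]lfunE gK.
exists (g^-1)%VF; split; first by exists g.
move=> x y; apply: (can_inj gK); rewrite gK' lfunE /= (heis_mapM zZ ef).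
by rewrite -![heis_map _ _ _ _]lfunE -/g !gK'.
Qed.

Theorem theorem24 (F : fieldType) :
  (forall (n : nat) (L : lieAlgType F),
     in_Lie n 1 L -> indecomposable L ->
     (graph_connected (commuting_graph L) <->
     exists m : nat, (2 <= m)%N /\ lie_isomorphic L (heisenberg F m))) /\
  (forall m : nat, (2 <= m)%N ->
     diameter_is (commuting_graph (heisenberg F m)) 2).
Proof.
split=> [n L [_ d1] indec|m m2]; last first.
  apply: diameter2_of_large_center_codim; first exact: dim_heis_derived.
    by apply: heis_derived_neq0; apply: ltnW.
  exact: heisenberg_large_center_codim.
have dN0 : derived L != 0%VS by rewrite -dimv_eq0 d1.
have d1' : (\dim (derived L) <= 1)%N by rewrite d1.
split=> [conn|[m [m2 iso]]]; last first.
  have [dimL dimZ] := lie_isomorphic_dim iso.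
  have big : (\dim (lie_center L) + 2 < \dim {:L})%N.
    by have := heisenberg_large_center_codim F m2; rewrite -dimL; lia.
  by have [] := diameter2_of_large_center_codim d1' dN0 big.
have big : (\dim (lie_center L) + 2 < \dim {:L})%N.
  by rewrite ltnNge; apply/negP => /(disconnected_of_small_center_codim dN0).
have ZD : lie_center L = derived L.
  apply/eqP; rewrite eqEsubv center_sub_derived_of_indecomposable //=.
  apply: contraLR big => /(small_center_codim_of_noncentral_derived d1').
  by rewrite -leqNgt.
have [m iso] := isomorphic_heisenberg d1 ZD; exists m; split=> //.
have [dimL _] := lie_isomorphic_dim iso.
by move: big; rewrite ZD d1 dimL dim_heisenberg; lia.
Qed.
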